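(* Let $R$ be a ring, let $(\mathcal{A},\mathcal{B})$ be a hereditary cotorsion pair of finite type in the category of right $R$-modules, and let $\mu$ be an infinite cardinal. If $M$ is a right $R$-module belonging to $\mathcal{A}$ that is $<\mu$-generated, then $M\in \mathcal{A}\cap \mathrm{mod}_{<\mu}\text{-}R$; that is, $M\in\mathcal{A}$ and $M$ has a projective resolution consisting of $<\mu$-generated projective modules.
   Context: Rings are associative with unit. For a class $\mathcal{C}$ of right $R$-modules, $\mathcal{C}^{\perp}=\{X : \mathrm{Ext}_R^i(C,X)=0 \text{ for all } C\in\mathcal{C},\ i\ge 1\}$ and ${}^{\perp}\mathcal{C}=\{X : \mathrm{Ext}_R^i(X,C)=0 \text{ for all } C\in\mathcal{C},\ i\ge 1\}$. A hereditary cotorsion pair is a pair $(\mathcal{A},\mathcal{B})$ of classes of right $R$-modules with $\mathcal{A}={}^{\perp}\mathcal{B}$ and $\mathcal{B}=\mathcal{A}^{\perp}$. For an infinite cardinal $\mu$, $\mathrm{mod}_{<\mu}\text{-}R$ is the class of right $R$-modules having a projective resolution consisting of $<\mu$-generated projective modules (that is, projective modules generated by a set of cardinality $<\mu$); $\mathrm{mod}\text{-}R=\mathrm{mod}_{<\aleph_0}\text{-}R$. A hereditary cotorsion pair $(\mathcal{A},\mathcal{B})$ is of finite type if there is a class $\mathcal{S}\subseteq \mathrm{mod}\text{-}R$ such that $\mathcal{S}^{\perp}=\mathcal{B}$. *)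

(* Defs.v *)
From HB Require Import structures.
From mathcomp Require Import all_boot all_order all_algebra.
From mathcomp Require Import boolp classical_sets functions cardinality.

Set Implicit Arguments.
Unset Strict Implicit.
Unset Printing Implicit Defensive.

Import GRing.Theory.

Local Open Scope classical_set_scope.
Local Open Scope card_scope.
Local Open Scope ring_scope.

(* Right R-modules are left modules over the converse ring: for m : rmodType R,
   [a *: m] is the element written m a in right-module notation. Rings are
   pzRingType, so the zero ring is allowed. *)
Notation rmodType R := (GRing.Lmodule.type R^c).

Notation rmodClass R := (rmodType R -> Prop).

(* An infinite cardinal mu is represented by a type K of cardinality mu. *)
Definition card_lt (T : Type) (A : set T) (K : Type) : Prop :=
  A #<= [set: K] /\ ~~ ([set: K] #<= A).

Definition generates (R : pzRingType) (M : rmodType R) (X : set M) : Prop :=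
  forall m : M, exists (n : nat) (a : 'I_n -> R^c) (x : 'I_n -> M),
    (forall i, X (x i)) /\ m = \sum_(i < n) a i *: x i.

Definition lt_generated (K : Type) (R : pzRingType) (M : rmodType R) : Prop :=
  exists X : set M, card_lt X K /\ generates X.

Definition projective (R : pzRingType) (P : rmodType R) : Prop :=
  forall (M N : rmodType R) (g : {linear M -> N}) (f : {linear P -> N}),
    range g = setT -> exists h : {linear P -> M}, forall x, g (h x) = f x.

(* ... -> P_2 -d_1-> P_1 -d_0-> P_0 -e-> M -> 0 *)
Record proj_resolution (R : pzRingType) (M : rmodType R) := ProjResolution {
  res_obj :> nat -> rmodType R;
  res_d : forall n, {linear res_obj n.+1 -> res_obj n};
  res_aug : {linear res_obj 0%N -> M};
  res_projective : forall n, projective (res_obj n);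
  res_aug_surj : range res_aug = setT;
  res_exact0 : range (res_d 0%N) = res_aug @^-1` [set 0];
  res_exactS : forall n, range (res_d n.+1) = res_d n @^-1` [set 0]
}.

Section Ext.
Variables (R : pzRingType) (M : rmodType R) (P : proj_resolution M).
Variable N : rmodType R.

Definition is_cocycle (i : nat) (f : {linear P i -> N}) : Prop :=
  forall x, f (res_d P i x) = 0.

Definition is_coboundary (i : nat) : {linear P i -> N} -> Prop :=
  match i with
  | 0%N => fun f => forall x, f x = 0
  | j.+1 => fun f => exists g : {linear P j -> N},
                       forall x, f x = g (res_d P j x)
  end.

End Ext.

(* Ext^i_R(M, N) = 0, where Ext^i_R(M, N) is the i-th cohomology group of
   Hom_R(P, N) for a projective resolution P of M. That group does not depend
   on P up to isomorphism, so we quantify over all P. *)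
Definition Ext_eq0 (R : pzRingType) (i : nat) (M N : rmodType R) : Prop :=
  forall (P : proj_resolution M) (f : {linear P i -> N}),
    is_cocycle f -> is_coboundary f.

Definition right_perp (R : pzRingType) (C : rmodClass R) : rmodClass R :=
  fun X => forall Y, C Y -> forall i : nat, (1 <= i)%N -> Ext_eq0 i Y X.

Definition left_perp (R : pzRingType) (C : rmodClass R) : rmodClass R :=
  fun X => forall Y, C Y -> forall i : nat, (1 <= i)%N -> Ext_eq0 i X Y.

Definition hereditary_cotorsion_pair (R : pzRingType) (A B : rmodClass R) :
    Prop :=
  (forall X, A X <-> left_perp B X) /\ (forall X, B X <-> right_perp A X).

(* mod_{<mu}-R *)
Definition mod_lt (K : Type) (R : pzRingType) : rmodClass R :=
  fun M => exists P : proj_resolution M, forall n, lt_generated K (P n).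

(* S is contained in mod-R = mod_{<aleph_0}-R, hence K := nat. *)
Definition finite_type (R : pzRingType) (B : rmodClass R) : Prop :=
  exists S : rmodClass R, (forall X, S X -> mod_lt nat X) /\
    (forall X, B X <-> right_perp S X).

(* Main.v *)
Require Import Defs.
From HB Require Import structures.
From mathcomp Require Import all_boot all_order all_algebra.
From mathcomp Require Import boolp classical_sets functions cardinality.
From mathcomp Require Import ring_quotient.

(* Resolve M by free modules P_n, with P_(n+1) free on as few generators of
   C := range (P_(n+1) -> P_n) as possible, and suppose that P_n is
   <mu-generated. Let a subset G of P_n index one copy of the injective
   cogenerator Hom_Z(R, Q/Z), and let N be the submodule of the product of
   these copies consisting of the families that vanish at all G containing
   some finite subset of C. As N is a directed union of products of injective
   modules and Ext^i(X, -) commutes with directed unions for X in mod-R, N lies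
   in B. Choosing for each G a map on P_n that kills span G, and does not kill C
   unless C is contained in span G, defines a cocycle P_(n+1) -> C -> N. It
   factors through some P_n -> N because Ext^(n+1)(M, N) = 0. Each of the
   <mu generators of P_n has an image vanishing beyond some finite subset of C,
   and the union G of these subsets satisfies C = span G. *)

Set Implicit Arguments.
Unset Strict Implicit.
Unset Printing Implicit Defensive.

Import GRing.Theory Num.Theory.
Import Quotient.

Local Open Scope classical_set_scope.
Local Open Scope card_scope.
Local Open Scope quotient_scope.
Local Open Scope ring_scope.

(** * Cardinality *)

Lemma card_lt_le (T U : Type) (A : set T) (B : set U) (K : Type) :
  B #<= A -> card_lt A K -> card_lt B K.
Proof.
move=> BA [AK nKA]; split; first exact: card_le_trans AK.
by apply: contra nKA => KB; exact: card_le_trans BA.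
Qed.

Lemma infinite_setX_nat (T : Type) (Y : set T) :
  infinite_set Y -> Y `*` [set: nat] #<= Y.
Proof.
elim/Ppointed: T => T in Y *; first by rewrite emptyE => /(_ (finite_set0 _)).
(* A maximal disjoint family E of injective sequences covers Y up to a finite
   set; E and nat * nat ~ nat then give a surjection from Y to Y `*` nat. *)
move=> infY; pose D := [set i : nat -> T | injective i /\ range i `<=` Y].
have [E [ED tE maxE]] := ex_maximal_disjoint_subcollection (fun i => range i) D.
have finC : finite_set (Y `\` \bigcup_(i in E) range i).
  apply: contrapT => /infiniteP/pcard_leP[i0].
  have [i injI ir] : exists2 i : nat -> T, injective i &
      forall n, (Y `\` \bigcup_(i in E) range i) (i n).
    exists i0; last by move=> n; exact: funS.
    by move=> a b; apply: (@inj _ _ _ i0); rewrite in_setT.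
  have nEi : ~ E i by move=> Ei; case: (ir 0%N) => _; apply; exists i.
  apply: (maxE (i |` E)).
  - split; first by move=> j; right.
    by move/(_ i (or_introl erefl)).
  - move=> j [/= ->|/ED//]; split=> // _ [n _ <-]; by case: (ir n).
  - move=> j k [/= ->|Ej] [/= ->|Ek] //; last exact: tE.
    + by move=> [_ [[n _ <-] kn]]; case: (ir n) => _; case; exists k.
    + move=> [x [jx [n _ nx]]]; case: (ir n) => _; case; exists j => //.
      by rewrite nx.
have [i0 Ei0] : E !=set0.
  apply/set0P/negP => /eqP E0; apply: infY; move: finC.
  by rewrite E0 bigcup_set0 setD0.
have [e eC] : exists e : nat -> T, Y `\` \bigcup_(i in E) range i `<=` range e.
  by have /pcard_surjP[e eC] := finite_set_countable finC; exists e.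
pose dec x := xget (i0, 0%N) [set p | E p.1 /\ p.1 p.2 = x].
have decE i n : E i -> dec (i n) = (i, n).
  move=> Ei; apply: xget_unique => // -[j k] /= [Ej jk].
  have ji : j = i by apply: tE => //; exists (i n); split; [exists k|exists n].
  by subst j; congr (_, _); case: (ED _ Ei) => + _; exact.
(* An index [k] codes a triple [(b, m, n)]; the flag [b] says whether the first coordinate comes
   from the sequence [i] or from the enumeration [e] of the leftover points. Only surjectivity
   matters, so the remaining values are arbitrary. *)
pose f x := let: (i, k) := dec x in
  if unpickle k is Some (b, m, n) then (if b : bool then i m else e m, n)
  else (i k, 0%N).
apply: card_le_trans (card_image_le f Y).
apply: subset_card_le => -[y n] [/= Yy _].
have [[i Ei [m _ im]]|nC] := pselect ((\bigcup_(i in E) range i) y).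
  exists (i (pickle (true, m, n))); last by rewrite /f decE// pickleK im.
  by case: (ED _ Ei) => _; apply; exists (pickle (true, m, n)).
have [m _ em] : range e y by exact: eC.
exists (i0 (pickle (false, m, n))); last by rewrite /f decE// pickleK em.
by case: (ED _ Ei0) => _; apply; exists (pickle (false, m, n)).
Qed.

Lemma card_bigcup_countable (T U : Type) (Y : set T) (F : T -> set U) :
  infinite_set Y -> (forall x, countable (F x)) -> \bigcup_(x in Y) F x #<= Y.
Proof.
elim/Ppointed: U => U in F *.
  by move=> *; rewrite [X in X #<= _]emptyE card_ge0.
move=> infY cF.
have /choice[e eF] x : exists e : nat -> U, F x `<=` range e.
  by have /pcard_surjP[e] := cF x; exists e.
apply: card_le_trans (infinite_setX_nat infY).
apply: card_le_trans (card_image_le (fun p => e p.1 p.2) _).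
by apply: subset_card_le => y [x Yx /eF[n _ <-]]; exists (x, n).
Qed.

(** A finite [Y] gives a finite union, which is below any infinite [K]; an infinite [Y] absorbs the
    finite pieces. Singular cardinals are therefore covered as well. *)
Lemma card_lt_bigcup_finite (T U K : Type) (Y : set T) (F : T -> set U) :
  infinite_set [set: K] -> card_lt Y K -> (forall x, finite_set (F x)) ->
  card_lt (\bigcup_(x in Y) F x) K.
Proof.
move=> infK YK finF; have [finY|infY] := pselect (finite_set Y).
  have finU : finite_set (\bigcup_(x in Y) F x) by exact: bigcup_finite.
  split; last by apply/negP => /card_le_finite/(_ finU).
  by apply: card_le_trans (finite_set_countable finU) _; exact/infiniteP.
apply: card_lt_le YK; apply: card_bigcup_countable => // x.
exact: finite_set_countable.
Qed.

(** * Characters of abelian groups *)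

Definition QmodZ : zmodType :=
  {quot ((Num.int_num_subdef : {pred rat}) : zmodClosed rat)}.

Lemma QmodZ_eq0 (x : rat) : (\pi_QmodZ x == 0) = (x \is a Num.int).
Proof.
have -> : (0 : QmodZ) = \pi_QmodZ 0 by rewrite raddf0.
by rewrite piE equivE subr0.
Qed.

(** Beyond divisibility, the solution is kept nonzero so that characters can separate points; for
    [s = 0] the class of 1/n serves, nonzero because n > 1. *)
Lemma QmodZ_div (n : nat) (s : QmodZ) :
  (1 < n)%N -> exists2 t, t != 0 & t *+ n = s.
Proof.
move=> n1; have n0 : n%:R != 0 :> rat by rewrite pnatr_eq0 -lt0n ltnW.
have nV (q : rat) : \pi_QmodZ (q / n%:R) *+ n = \pi_QmodZ q.
  by rewrite -raddfMn /= -(mulr_natr (q / _)) divfK.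
have [s0|s0] := eqVneq s 0; last first.
  exists (\pi_QmodZ (repr s / n%:R)); last by rewrite nV reprK.
  by apply: contraNneq s0 => t0; rewrite -[s]reprK -nV t0 mul0rn.
exists (\pi_QmodZ (1 / n%:R)); last first.
  by rewrite nV s0; apply/eqP; rewrite QmodZ_eq0.
rewrite QmodZ_eq0; apply/negP => /intrP[m].
rewrite div1r => /(congr1 ( *%R n%:R)); rewrite mulfV// => /esym e.
have : (Posz n * m)%:~R = 1%:~R :> rat by rewrite rmorphM.
move/intr_inj => /(congr1 absz); rewrite abszM absz_nat => /eqP.
by rewrite muln_eq1 => /andP[/eqP n1' _]; rewrite n1' in n1.
Qed.

Section Characters.
Variable G : zmodType.
Implicit Types (W : set (G * QmodZ)) (g : G).

(* The graph of a homomorphism from a subgroup of G to Q/Z. *)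
Definition partial_hom W :=
  [/\ W 0, forall p q, W p -> W q -> W (p - q) & forall t, W (0, t) -> t = 0].

(** Extension by one element, as in Baer's criterion; since [g] lies outside the domain, its value
    can even be chosen nonzero. *)
Lemma partial_hom_step W g : partial_hom W -> (forall s, ~ W (g, s)) ->
  exists W' t, [/\ partial_hom W', W `<=` W', W' (g, t) & t != 0].
Proof.
move=> [W0 WB Wf] ng.
have WN p : W p -> W (- p) by move=> Wp; rewrite -sub0r; apply: WB.
have WD p q : W p -> W q -> W (p + q).
  by move=> Wp Wq; rewrite -[q]opprK; apply: WB => //; apply: WN.
have Wn p n : W p -> W (p *+ n).
  by move=> Wp; elim: n => [|n IH]; rewrite ?mulr0n// mulrS; apply: WD.
have Wz p (m : int) : W p -> W (p *~ m).
  move=> Wp; case: m => n; first exact: Wn.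
  by rewrite NegzE mulrNz; apply/WN/Wn.
have fstZ (p : G * QmodZ) (m : int) : (p *~ m).1 = p.1 *~ m.
  exact: (raddfMz (@fst G QmodZ)).
(* If [t] agrees with [W] on every multiple of [g] in the domain, then [W] plus the multiples of
   [(g, t)] is again the graph of a function. *)
suff [t t0 tW] : exists2 t, t != 0 &
    forall (m : int) s, W (g *~ m, s) -> W ((g, t) *~ m).
  exists [set p | exists w (m : int), W w /\ p = w + (g, t) *~ m], t.
  split => //.
  - split; first by exists 0, 0; rewrite mulr0z addr0.
    + move=> _ _ [w [m [Ww ->]]] [w' [m' [Ww' ->]]]; exists (w - w'), (m - m').
      by split; [exact: WB|rewrite mulrzBr opprD addrACA].
    + move=> s [w [m [Ww e]]].
      have Wgm : W ((g, t) *~ m).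
        apply: (tW m (- w.2)); have /(congr1 fst)/= := e.
        rewrite fstZ/= => /esym/eqP; rewrite addrC addr_eq0 => /eqP ->.
        by move/WN: Ww; case: (w).
      by apply: Wf; rewrite e; apply: WD.
  - by move=> w Ww; exists w, 0; rewrite mulr0z addr0.
  - by exists 0, 1; rewrite mulr1z add0r.
(* If no positive multiple of [g] lies in the domain, any nonzero [t] is compatible. *)
have [[n [n0 [s gn]]]|nW] :=
    pselect (exists n : nat, (0 < n)%N /\ exists s, W (g *+ n, s)); last first.
  have [t t0 _] := @QmodZ_div 2 0 isT; exists t => // m s Wm.
  suff -> : m = 0 by rewrite mulr0z.
  apply: contrapT => m0; apply: nW; exists `|m|%N; rewrite absz_gt0.
  split; first exact/eqP.
  case: m {m0} Wm => k Wk; [by exists s|exists (- s)].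
  by have := WN _ Wk; rewrite NegzE mulrNz /= -[- (_, _)]/(- - _, - s) opprK.
have exn : exists n, (0 < n)%N && `[< exists s, W (g *+ n, s) >].
  by exists n; rewrite n0; apply/asboolP; exists s.
case: (ex_minnP exn) => {n0 s gn exn}n /andP[n0 /asboolP[s gn]] nmin.
(* The least [n] is not 1 because [g] is outside the domain, so [QmodZ_div] applies. *)
have [t t0 tn] : exists2 t, t != 0 & t *+ n = s.
  apply: QmodZ_div; rewrite ltn_neqAle n0 andbT; apply/eqP => n1.
  by apply: (ng s); rewrite -n1 in gn.
exists t => // m r Wm.
have Wgt : W ((g, t) *+ n).
  suff -> : (g, t) *+ n = (g *+ n, s) by [].
  by rewrite -tn; elim: n {n0 gn nmin tn} => // n IH; rewrite !mulrS IH.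
(* By minimality of [n], a multiple of [g] in the domain is a multiple of [g *+ n], where [t]
   already agrees with [W]. *)
suff n_m : (m %% n)%Z = 0.
  by rewrite (divz_eq m n) n_m addr0 mulrC mulrzA; apply: Wz.
have : (m %% n)%Z < n by rewrite ltz_pmod.
have : 0 <= (m %% n)%Z by rewrite modz_ge0// -lt0n.
have : W ((g *~ m, r) - ((g, t) *+ n) *~ (m %/ n)%Z).
  by apply: WB => //; apply: Wz.
rewrite {1}(divz_eq m n) mulrzDr mulrC mulrzA.
case: (m %% n)%Z => // k Wk _ kn; have [->//|k0] := posnP k.
suff : (n <= k)%N by rewrite leqNgt; move: kn; rewrite ltz_nat => ->.
apply: nmin; rewrite k0; apply/asboolP; move: Wk.
set p := (_ - _); have -> : p = (p.1, p.2) by case: (p).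
have -> : p.1 = g *+ k; last by exists p.2.
rewrite /p /= fstZ -/fst (raddfMn (@fst G QmodZ)).
by rewrite addrAC subrr add0r.
Qed.

Lemma partial_hom_total W : partial_hom W ->
  exists f : {additive G -> QmodZ}, forall g t, W (g, t) -> f g = t.
Proof.
(* Adjoining [W] inside [P] makes the empty chain harmless in Zorn's lemma. A maximal graph is total
   by [partial_hom_step]. *)
move=> Whom; pose P (V : set (G * QmodZ)) := partial_hom (W `|` V).
have [F FP Ftot|V [PV Vmax]] := @Zorn_bigcup _ P.
  have [F0|/set0P[V0 FV0]] := eqVneq F set0.
    by rewrite /P F0 bigcup_set0 setU0.
  have sub p q : (W `|` \bigcup_(X in F) X) p -> (W `|` \bigcup_(X in F) X) q ->
      exists V, [/\ F V, (W `|` V) p & (W `|` V) q].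
    move=> [Wp|[X FX Xp]] [Wq|[Y FY Yq]].
    - by exists V0; split=> //; left.
    - by exists Y; split=> //; [left|right].
    - by exists X; split=> //; [right|left].
    - have [XY|YX] := Ftot _ _ FX FY.
      + by exists Y; split=> //; right=> //; apply: XY.
      + by exists X; split=> //; right=> //; apply: YX.
  split.
  - by left; case: Whom.
  - move=> p q Up Uq; have [V [FV Vp Vq]] := sub p q Up Uq.
    have [_ VB _] := FP _ FV; have [Wpq|Vpq] := VB _ _ Vp Vq; [by left|].
    by right; exists V.
  - move=> t Ut; have [V [FV Vt _]] := sub _ _ Ut Ut.
    by have [_ _] := FP _ FV; apply.
pose U := W `|` V.
have Utot g : exists t, U (g, t).
  apply: contrapT => /forallNP ng.
  have [U' [t [U'hom UU' U't t0]]] := partial_hom_step PV ng.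
  apply: (Vmax U'); last first.
    by rewrite /P setUidr//; apply: subset_trans UU'; left.
  split; first by apply: subset_trans UU'; right.
  by move=> /(_ _ U't) Vt; apply: (ng t); right.
have [f Uf] := choice Utot; have [U0 UB U1] := PV.
have Uinj g s t : U (g, s) -> U (g, t) -> s = t.
  move=> gs gt; apply/eqP; rewrite -subr_eq0; apply/eqP/U1.
  have : U (g - g, s - t) by exact: (UB _ _ gs gt).
  by rewrite subrr.
have fB : zmod_morphism f.
  move=> x y; apply: (@Uinj (x - y)); first exact: Uf.
  exact: (UB _ _ (Uf x) (Uf y)).
pose fA := GRing.isZmodMorphism.Build G QmodZ f fB.
exists (HB.pack f fA : {additive G -> QmodZ}) => g t Wgt.
by apply: (@Uinj g); [exact: Uf|left].
Qed.

End Characters.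

(** The zero character on [N] extends to [x] with a nonzero value when [x] is outside [N], and from
    there to all of [G]. *)
Lemma character_separates (G : zmodType) (N : set G) :
  N 0 -> (forall x y, N x -> N y -> N (x - y)) ->
  forall x, exists2 f : {additive G -> QmodZ},
    forall y, N y -> f y = 0 & (~ N x -> f x != 0).
Proof.
move=> N0 NB x; pose W := [set p : G * QmodZ | N p.1 /\ p.2 = 0].
have Whom : partial_hom W.
  split=> [|p q [Np p0] [Nq q0]|t []//]; first by split.
  by split; [exact: NB|rewrite /= p0 q0 subrr].
have [Nx|Nx] := pselect (N x).
  have [f fW] := partial_hom_total Whom.
  by exists f => // y Ny; apply: fW.
have [|W' [t [W'hom WW' W't t0]]] := @partial_hom_step _ W x Whom.
  by move=> s [].
have [f fW] := partial_hom_total W'hom; exists f => [y Ny|_].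
  by apply: fW; apply: WW'.
by rewrite (fW _ _ W't).
Qed.

(** Injectivity of Q/Z: as [chi] kills the kernel of [d], it descends to a character of the image of
    [d], which extends to [H]. *)
Lemma character_extends (G H : zmodType) (d : {additive G -> H})
    (chi : {additive G -> QmodZ}) : (forall x, d x = 0 -> chi x = 0) ->
  exists psi : {additive H -> QmodZ}, forall x, psi (d x) = chi x.
Proof.
move=> dchi; pose W := [set p | exists x, p = (d x, chi x)].
have [|f fW] := @partial_hom_total _ W.
  split=> [|_ _ [x ->] [y ->]|t [x [dx ->]]]; last exact: dchi.
  - by exists 0; rewrite !raddf0.
  - by exists (x - y); rewrite !raddfB.
by exists f => x; apply: fW; exists x.
Qed.

(** * Free modules *)

Section FreeModule.
Variables (S : pzRingType) (I : choiceType) (X : set I).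

(** The basis is a set in an ambient type, so kernels and generating sets can serve as bases without
    forming subtypes. *)
Definition free_pred : {pred I -> S^o} :=
  fun f => `[< finite_set [set x | f x != 0] /\ [set x | f x != 0] `<=` X >].

Lemma free_pred_submod : GRing.submod_closed free_pred.
Proof.
split=> [|a f g /asboolP[ff fX] /asboolP[gf gX]]; apply/asboolP.
  rewrite (_ : [set x | _] = set0) -?subset0; last by move=> x /=; rewrite eqxx.
  by split; [exact: finite_set0|].
have sub : [set x | (a *: f + g) x != 0] `<=`
    [set x | f x != 0] `|` [set x | g x != 0].
  move=> x /=; rewrite -[_ x]/(a * f x + g x).
  have [->|] := eqVneq (f x) 0; last by left.
  by rewrite mulr0 add0r; right.
split; first by apply: sub_finite_set sub _; rewrite finite_setU.
by move=> x /sub[/fX|/gX].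
Qed.

HB.instance Definition _ :=
  GRing.isSubmodClosed.Build S (I -> S^o) free_pred free_pred_submod.

Definition free_mod := {f : I -> S^o | free_pred f}.
HB.instance Definition _ := SubChoice.on free_mod.
HB.instance Definition _ := [SubChoice_isSubLmodule of free_mod by <:].

Lemma free_supp (f : free_mod) : exists s : seq I,
  uniq s /\ forall x, (x \in s) = (val f x != 0).
Proof.
have /asboolP[/finite_seqP[s es] _] := valP f.
exists (undup s); split=> [|x]; first exact: undup_uniq.
rewrite mem_undup; apply/idP/idP => [xs|fx0].
  by have : [set` s] x by []; rewrite -es.
by have : [set x | val f x != 0] x by []; rewrite es.
Qed.

Definition supp f : seq I := sval (cid (free_supp f)).

Lemma supp_uniq f : uniq (supp f).
Proof. by rewrite /supp; case: cid => s []. Qed.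

Lemma mem_supp f x : (x \in supp f) = (val f x != 0).
Proof. by rewrite /supp; case: cid => s []. Qed.

Section Eval.
Variables (N : lmodType S) (u : I -> N).

Definition free_eval (f : free_mod) : N :=
  \sum_(x <- supp f) (val f x : S) *: u x.

(** Extra terms have coefficient zero. This provides one common index list when several elements are
    compared, as in linearity. *)
Lemma free_evalE f s : uniq s -> {subset supp f <= s} ->
  free_eval f = \sum_(x <- s) (val f x : S) *: u x.
Proof.
move=> us fs; rewrite (bigID (fun x => val f x != 0))/= [X in _ + X]big1 ?addr0.
  rewrite -big_filter; apply/perm_big/uniq_perm.
  - exact: supp_uniq.
  - exact: filter_uniq.
  - move=> x; rewrite mem_filter -mem_supp.
    by case: (boolP (x \in supp f)) => // /fs ->.
by move=> x /negPn/eqP ->; rewrite scale0r.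
Qed.

Lemma free_eval_linear : linear free_eval.
Proof.
move=> a f g; pose s := undup (supp f ++ supp g ++ supp (a *: f + g)).
have us : uniq s by exact: undup_uniq.
rewrite !(@free_evalE _ s)//;
  try by move=> x xf; rewrite mem_undup !mem_cat xf ?orbT.
rewrite scaler_sumr -big_split; apply: eq_bigr => x _ /=.
by rewrite scalerA -scalerDl.
Qed.

HB.instance Definition _ :=
  GRing.isLinear.Build S free_mod N *:%R free_eval free_eval_linear.

End Eval.

(** Outside [X] the value is 0, the default of [insubd]. *)
Definition free_gen (x : I) : free_mod := insubd 0 (fun y => (y == x)%:R : S^o).

Lemma free_genE x : X x -> val (free_gen x) = fun y => (y == x)%:R.
Proof.
move=> Xx; rewrite val_insubd ifT//; apply/asboolP.
have sub : [set y | (y == x)%:R != 0 :> S] `<=` [set x].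
  by move=> y /=; case: (y =P x) => // _; rewrite eqxx.
split; last by move=> y /sub ->.
by apply: sub_finite_set sub _; exact: finite_set1.
Qed.

Lemma free_eval_gen (N : lmodType S) (u : I -> N) x :
  X x -> free_eval u (free_gen x) = u x.
Proof.
move=> Xx; rewrite (@free_evalE _ _ _ [:: x])// => [|y].
  by rewrite big_seq1 free_genE// eqxx scale1r.
by rewrite mem_supp free_genE// inE; case: (y =P x) => // _; rewrite eqxx.
Qed.

Lemma free_val_sum (J : Type) (r : seq J) (F : J -> free_mod) y :
  val (\sum_(j <- r) F j) y = \sum_(j <- r) val (F j) y.
Proof. by elim/big_rec2: _ => //= j a b _ <-. Qed.

Lemma free_suppX f x : x \in supp f -> X x.
Proof. by rewrite mem_supp; have /asboolP[_] := valP f; apply. Qed.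

Lemma free_expand f : f = \sum_(x <- supp f) (val f x : S) *: free_gen x.
Proof.
apply/val_inj/funext => y; rewrite free_val_sum.
have e x : x \in supp f ->
    val ((val f x : S) *: free_gen x) y = if y == x then val f x else 0.
  move=> /free_suppX Xx; rewrite -[LHS]/((val f x : S) * val (free_gen x) y).
  by rewrite free_genE//; case: ifP; rewrite ?mulr1 ?mulr0.
rewrite (eq_big_seq _ e); have [yf|yf] := boolP (y \in supp f).
  rewrite (bigD1_seq y)//= ?supp_uniq// eqxx big1 ?addr0// => x xy.
  by rewrite eq_sym (negPf xy).
have /eqP -> : val f y == 0 by rewrite mem_supp negbK in yf.
by rewrite big_seq big1// => x xf; case: eqP => // yx; rewrite yx xf in yf.
Qed.

End FreeModule.

Section RightModules.
Variable R : pzRingType.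

Lemma free_projective (I : choiceType) (X : set I) :
  projective (free_mod R^c X : rmodType R).
Proof.
move=> M N g f gsurj.
have /choice[u uE] x : exists m, g m = f (free_gen R^c X x).
  have [m _ gm] : range g (f (free_gen R^c X x)) by rewrite gsurj.
  by exists m.
exists (free_eval u : {linear _ -> _}) => p.
rewrite [in RHS](free_expand p) !linear_sum; apply: eq_bigr => x _.
by rewrite !linearZ_LR /= uE.
Qed.

Lemma free_generates (I : choiceType) (X : set I) :
  generates (free_gen R^c X @` X : set (free_mod R^c X : rmodType R)).
Proof.
move=> f; pose s := supp f.
exists (size s), (fun i => val f (tnth (in_tuple s) i)),
  (fun i => free_gen R^c X (tnth (in_tuple s) i)); split.
  move=> i; eexists; [|reflexivity].
  by apply: (@free_suppX _ _ _ f); exact: mem_tnth.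
by rewrite [LHS]free_expand big_tnth.
Qed.

Lemma free_lt_generated (I : choiceType) (X : set I) (K : Type) :
  card_lt X K -> lt_generated K (free_mod R^c X : rmodType R).
Proof.
move=> XK; exists (free_gen R^c X @` X); split; last exact: free_generates.
by apply: card_lt_le XK; exact: card_image_le.
Qed.

End RightModules.

(** * Comparison of projective resolutions *)

Section Kernel.
Variables (S : pzRingType) (V W : lmodType S) (d : {linear V -> W}).

Definition ker_pred : {pred V} := fun x => d x == 0.

Lemma ker_pred_submod : GRing.submod_closed ker_pred.
Proof.
split=> [|a x y /eqP dx /eqP dy]; first by rewrite unfold_in linear0.
by rewrite unfold_in linearP dx dy scaler0 addr0.
Qed.

HB.instance Definition _ :=
  GRing.isSubmodClosed.Build S V ker_pred ker_pred_submod.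

Definition ker := {x : V | ker_pred x}.
HB.instance Definition _ := SubChoice.on ker.
HB.instance Definition _ := [SubChoice_isSubLmodule of ker by <:].

Variables (U : lmodType S) (f : {linear U -> V}).
Hypothesis df : forall x, d (f x) = 0.

Definition ker_lift (x : U) : ker := exist _ (f x) (introT eqP (df x)).

Lemma ker_lift_linear : linear ker_lift.
Proof. by move=> a x y; apply: val_inj; rewrite /= linearP. Qed.

HB.instance Definition _ := GRing.isLinear.Build S U ker *:%R ker_lift
  ker_lift_linear.

End Kernel.

(** The invariant [OK] travels with each term through the recursion, since a next term is only
    available where it holds. *)
Lemma dependent_choice (T : nat -> Type) (OK : forall n, T n -> Prop)
    (step : forall n, T n -> T n.+1 -> Prop) (a0 : T 0%N) :
  OK _ a0 -> (forall n a, OK n a -> exists2 b, OK _ b & step n a b) ->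
  exists2 f : forall n, T n, f 0%N = a0 & forall n, step n (f n) (f n.+1).
Proof.
move=> a0P stepP.
have next n (a : {a : T n | OK n a}) :
    {b : {b : T n.+1 | OK n.+1 b} | step n (sval a) (sval b)}.
  apply: cid; case: a => a aP; have [b bP ab] := stepP n a aP.
  by exists (exist _ b bP).
pose F := fix F n : {a : T n | OK n a} :=
  if n is k.+1 then sval (next k (F k)) else exist _ a0 a0P.
exists (fun n => sval (F n)) => // n.
exact: svalP (next n (F n)).
Qed.

Section Comparison.
Variable R : pzRingType.

(** By exactness [d] maps onto the kernel of [b], through which [f] factors; projectivity is applied
    to that surjection. *)
Lemma projective_lift (P V W U : rmodType R) (d : {linear V -> W})
    (b : {linear W -> U}) (f : {linear P -> W}) :
  projective P -> range d = b @^-1` [set 0] -> (forall x, b (f x) = 0) ->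
  exists h : {linear P -> V}, forall x, d (h x) = f x.
Proof.
move=> Pproj dex bf.
have bd x : b (d x) = 0.
  by have : range d (d x) by [exists x]; rewrite dex.
have [|h hE] := Pproj V (ker b : rmodType R) (ker_lift bd : {linear _ -> _})
    (ker_lift bf : {linear _ -> _}).
  apply/seteqP; split=> // -[x bx] _.
  have [y _ dy] : range d x by rewrite dex; apply/eqP.
  by exists y => //; apply: val_inj.
by exists h => x; have /(congr1 val) := hE x.
Qed.

Section Boundary.
Variables (M : rmodType R) (P : proj_resolution M).

(** Counting the augmentation as the boundary map of degree 0 lets all degrees be treated
    uniformly. *)
Definition bd_target n : rmodType R := if n is k.+1 then P k else M.

Definition bd n : {linear P n -> bd_target n} :=
  match n with 0%N => res_aug P | k.+1 => res_d P k end.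

Lemma bd_exact n : range (res_d P n) = bd n @^-1` [set 0].
Proof. by case: n => [|n]; [exact: res_exact0|exact: res_exactS]. Qed.

Lemma bd_res_d n x : bd n (res_d P n x) = 0.
Proof.
by have : range (res_d P n) (res_d P n x) by [exists x]; rewrite bd_exact.
Qed.

Lemma bd_lift (V : rmodType R) n (f : {linear V -> P n}) :
  projective V -> (forall x, bd n (f x) = 0) ->
  exists h : {linear V -> P n.+1}, forall x, res_d P n (h x) = f x.
Proof. by move=> Vproj; apply: projective_lift => //; exact: bd_exact. Qed.

End Boundary.

Variable M : rmodType R.
Implicit Types P Q : proj_resolution M.

Lemma chain_map_exists P Q : exists2 u : forall n, {linear P n -> Q n},
  forall x, res_aug Q (u 0%N x) = res_aug P x &
  forall n x, res_d Q n (u n.+1 x) = u n (res_d P n x).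
Proof.
have [u0 u0E] :=
  @res_projective _ _ P 0%N _ _ (res_aug Q) (res_aug P) (res_aug_surj Q).
(* Preserving cycles is exactly what allows [u] composed with the differential to be lifted one
   degree higher. *)
pose OK n (u : {linear P n -> Q n}) :=
  forall x, bd P n x = 0 -> bd Q n (u x) = 0.
have [||u uu0 uS] := @dependent_choice _ OK
    (fun n u v => forall x, res_d Q n (v x) = u (res_d P n x)) u0.
- by move=> x; rewrite /= u0E.
- move=> n u OKu.
  have [|v vE] :=
    @bd_lift _ Q _ n (u \o res_d P n) (@res_projective _ _ P n.+1).
    by move=> x /=; apply: OKu; exact: bd_res_d.
  by exists v => // x dx; rewrite /= vE /= dx linear0.
by exists u => //; rewrite uu0.
Qed.

Lemma null_homotopy P (w : forall n, {linear P n -> P n}) :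
  (forall x, res_aug P (w 0%N x) = 0) ->
  (forall n x, res_d P n (w n.+1 x) = w n (res_d P n x)) ->
  exists h : forall n, {linear P n -> P n.+1},
    forall n x, res_d P n.+1 (h n.+1 x) = w n.+1 x - h n (res_d P n x).
Proof.
move=> w0 wS.
have [h0 h0E] := @bd_lift _ P _ 0%N (w 0%N) (@res_projective _ _ P 0%N) w0.
(* On cycles the homotopy equation reduces to this; applied to boundaries, it makes the next map to
   be lifted land in the cycles. *)
pose OK n (h : {linear P n -> P n.+1}) :=
  forall x, bd P n x = 0 -> res_d P n (h x) = w n x.
have [||h _ hS] := @dependent_choice _ OK (fun n h k =>
    forall x, res_d P n.+1 (k x) = w n.+1 x - h (res_d P n x)) h0.
- by move=> x _.
- move=> n h OKh.
  have [|k kE] := @bd_lift _ P _ n.+1 (w n.+1 \- (h \o res_d P n))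
      (@res_projective _ _ P n.+1).
    by move=> x /=; rewrite linearB /= wS OKh ?subrr//; exact: bd_res_d.
  by exists k => // x /= dx; rewrite kE /= dx linear0 subr0.
by exists h.
Qed.

(** Pull [f] back to [Q] along [v], bound it there, and return along [u]; the homotopy from [v u] to
    the identity corrects the result. Vanishing of Ext thus needs checking on a single resolution
    only. *)
Lemma Ext_comparison P Q (N : rmodType R) (j : nat) :
  (forall f : {linear Q j.+1 -> N}, is_cocycle f -> is_coboundary f) ->
  forall f : {linear P j.+1 -> N}, is_cocycle f -> is_coboundary f.
Proof.
move=> QN f fd.
have [u u0 uS] := chain_map_exists P Q; have [v v0 vS] := chain_map_exists Q P.
have [||h hE] := @null_homotopy P (fun n => (v n \o u n) \- idfun).
- by move=> x; rewrite /= linearB /= v0 u0 subrr.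
- by move=> n x; rewrite /= linearB /= vS uS.
have [|g gE] := QN (f \o v j.+1); first by move=> x; rewrite /= -vS fd.
exists ((g \o u j) \- (f \o h j)) => x /=.
rewrite -uS -gE /=; have /(congr1 f) := hE j x.
rewrite fd !linearB /= => /esym/eqP; rewrite subr_eq0 => /eqP <-.
by rewrite subKr.
Qed.

End Comparison.

(** * The coefficient module *)

Section Span.
Variables (S : pzRingType) (V : lmodType S).
Implicit Types G N : set V.

Definition submod N := N 0 /\ forall a x y, N x -> N y -> N (a *: x + y).

(** In this form, a property of generators passes to the span as soon as it cuts out a submodule. *)
Definition span G : set V :=
  [set x | forall N, submod N -> G `<=` N -> N x].

Lemma span_submod G : submod (span G).
Proof.
split=> [N [N0 _] //|a x y Gx Gy N subN GN].
by have [_ NL] := subN; apply: NL; [exact: Gx|exact: Gy].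
Qed.

Lemma sub_span G : G `<=` span G.
Proof. by move=> x Gx N _; apply. Qed.

Lemma submod_ker (W : lmodType S) (f : {linear V -> W}) :
  submod [set x | f x = 0].
Proof.
split; first exact: linear0.
by move=> a x y /= fx fy; rewrite linearP fx fy scaler0 addr0.
Qed.

End Span.

Lemma generates_span (R : pzRingType) (M : rmodType R) (X : set M) :
  generates X -> forall m, span X m.
Proof.
move=> Xgen m; have [n [a [x [xX ->]]]] := Xgen m.
have [s0 sL] := span_submod X.
elim/big_rec: _ => // i y _ Xy; apply: sL => //; exact: sub_span.
Qed.

Section CoefficientModule.
Variables (S : pzRingType) (V : lmodType S) (C : set V).

(** Vanishing on a member of a filter of index sets: finite subsets of [C] are closed under union,
    whence closure under differences. *)
Definition eventually_zero (a : set V -> S -> QmodZ) :=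
  exists2 b : set V, finite_set b /\ b `<=` C &
    forall G, b `<=` G -> forall r, a G r = 0.

Definition coef_pred : {pred (set V -> S -> QmodZ)} := fun a =>
  `[< (forall G, zmod_morphism (a G)) /\ eventually_zero a >].

Lemma coef_pred_zmod : zmod_closed coef_pred.
Proof.
split=> [|a b /asboolP[aB [b1 [fb1 b1C] a1]] /asboolP[bB [b2 [fb2 b2C] a2]]];
  apply/asboolP.
  split; first by move=> G x y; rewrite /= subr0.
  by exists set0 => //; split=> //; exact: finite_set0.
split=> [G x y|].
  rewrite -[LHS]/(a G (x - y) - b G (x - y)) aB bB.
  by rewrite -[RHS]/(a G x - b G x - (a G y - b G y)) !opprD addrACA.
exists (b1 `|` b2); first by split; [rewrite finite_setU|rewrite subUset].
move=> G bG r; rewrite -[LHS]/(a G r - b G r) a1 ?a2 ?subrr//.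
  by apply: subset_trans bG; right.
by apply: subset_trans bG; left.
Qed.

HB.instance Definition _ :=
  GRing.isZmodClosed.Build (set V -> S -> QmodZ) coef_pred coef_pred_zmod.

(* The additive maps S -> Q/Z form the left S-module Hom_Z(S, Q/Z) under
   (s a)(r) = a(r s); S-linear maps from U into it correspond to additive maps
   U -> Q/Z through evaluation at 1. *)
Definition coef := {a : set V -> S -> QmodZ | coef_pred a}.
HB.instance Definition _ := SubChoice.on coef.
HB.instance Definition _ := [SubChoice_isSubZmodule of coef by <:].

Lemma coefB (c : coef) G : zmod_morphism (val c G).
Proof. by have /asboolP[] := valP c. Qed.

Lemma coef_zero (c : coef) : eventually_zero (val c).
Proof. by have /asboolP[] := valP c. Qed.

Lemma coef_scale_subproof (s : S) (c : coef) :
  coef_pred (fun G r => val c G (r * s)).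
Proof.
apply/asboolP; split=> [G x y|]; first by rewrite mulrBl coefB.
by have [b bC b0] := coef_zero c; exists b => // G bG r; exact: b0.
Qed.

Definition coef_scale (s : S) (c : coef) : coef :=
  exist (fun a => coef_pred a) _ (coef_scale_subproof s c).

Lemma coef_scaleA a b c : coef_scale a (coef_scale b c) = coef_scale (a * b) c.
Proof. by apply/val_inj/funext => G; apply/funext => r /=; rewrite mulrA. Qed.

Lemma coef_scale1 : left_id 1 coef_scale.
Proof.
by move=> c; apply/val_inj/funext => G; apply/funext => r /=; rewrite mulr1.
Qed.

Lemma coef_scaleDr : right_distributive coef_scale +%R.
Proof. by move=> s a b; apply/val_inj/funext => G; apply/funext => r. Qed.

Lemma coef_scaleDl c : {morph coef_scale^~ c : a b / a + b}.
Proof.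
move=> a b; apply/val_inj/funext => G; apply/funext => r /=.
rewrite mulrDr -[RHS]/(val c G (r * a) + val c G (r * b)).
have cB := coefB c G; have c0 : val c G 0 = 0 by have := cB 0 0; rewrite !subrr.
rewrite -[b in LHS]opprK mulrN cB mulrN -[X in _ - val c G X]add0r cB c0.
by rewrite sub0r opprK.
Qed.

HB.instance Definition _ := GRing.Zmodule_isLmodule.Build S coef
  coef_scaleA coef_scale1 coef_scaleDr coef_scaleDl.

Lemma coef_valZ s (c : coef) G r : val (s *: c) G r = val c G (r * s).
Proof. by []. Qed.

Lemma coef_valB (c c' : coef) G r : val (c - c') G r = val c G r - val c' G r.
Proof. by []. Qed.

Lemma coef_valD (c c' : coef) G r : val (c + c') G r = val c G r + val c' G r.
Proof. by []. Qed.

Section CoefMap.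
Variables (U : lmodType S) (chi : set V -> {additive U -> QmodZ}).
Hypothesis chi0 : forall x, eventually_zero (fun G r => chi G (r *: x)).

Lemma coef_map_subproof (x : U) : coef_pred (fun G r => chi G (r *: x)).
Proof. by apply/asboolP; split=> // G r s; rewrite scalerBl raddfB. Qed.

(** The passage from families of characters to linear maps; [coef_eval] goes back. *)
Definition coef_map (x : U) : coef :=
  exist (fun a => coef_pred a) _ (coef_map_subproof x).

Lemma coef_map_linear : linear coef_map.
Proof.
move=> a x y; apply/val_inj/funext => G; apply/funext => r.
by rewrite coef_valD coef_valZ /= scalerDr raddfD scalerA.
Qed.

HB.instance Definition _ := GRing.isLinear.Build S U coef *:%R coef_map
  coef_map_linear.

End CoefMap.

Section CoefEval.
Variables (U : lmodType S) (f : {linear U -> coef}) (G : set V).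

(** Vanishing at every [r], rather than at 1 alone, is stable under scalars. *)
Lemma coef_zero_submod : submod [set x | forall r, val (f x) G r = 0].
Proof.
split=> [r|a x y x0 y0 r]; first by rewrite linear0.
by rewrite linearP coef_valD coef_valZ x0 y0 addr0.
Qed.

Definition coef_eval (x : U) : QmodZ := val (f x) G 1.

Lemma coef_eval_zmod : zmod_morphism coef_eval.
Proof. by move=> x y; rewrite /coef_eval linearB coef_valB. Qed.

HB.instance Definition _ := GRing.isZmodMorphism.Build U QmodZ coef_eval
  coef_eval_zmod.

Lemma coef_eval_scale r x : coef_eval (r *: x) = val (f x) G r.
Proof. by rewrite /coef_eval linearZ_LR coef_valZ mul1r. Qed.

End CoefEval.

End CoefficientModule.

Lemma free_eval_range (S : pzRingType) (V : lmodType S) (X : set V) :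
  range (free_eval (@idfun V) : free_mod S X -> V) = span X.
Proof.
apply/seteqP; split=> [_ [f _ <-]|x Xx].
  have [s0 sL] := span_submod X; rewrite /free_eval big_seq.
  elim/big_rec: _ => // y v /free_suppX Xy Xv; apply: sL => //; exact: sub_span.
apply: Xx => [|y Xy]; last by exists (free_gen S X y); rewrite ?free_eval_gen.
split; first by exists 0; rewrite ?linear0.
by move=> a _ _ [f _ <-] [g _ <-]; exists (a *: f + g); rewrite ?linearP.
Qed.

(** * Vanishing of Ext with values in the coefficient module *)

Section CoefficientExt.
Variable R : pzRingType.

(** On a resolution with finitely generated terms, the bounds for the images of finitely many
    generators have a finite union [B], which bounds the whole cocycle at once. *)
Lemma coef_right_perp (S : rmodClass R) (V : rmodType R) (C : set V) :
  (forall X, S X -> mod_lt nat X) -> right_perp S (coef C : rmodType R).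
Proof.
move=> Sfin Y /Sfin[Q Qfin] [|j] // _ P.
apply: (@Ext_comparison _ _ P Q) => f fd.
have [X [[_ Xlt] Xgen]] := Qfin j.+1.
have finX : finite_set X by apply: contrapT => /infiniteP; exact/negP.
have /choice[b bP] x : exists b : set V, (finite_set b /\ b `<=` C) /\
    forall G, b `<=` G -> forall r, val (f x) G r = 0.
  by have [b b1 b2] := coef_zero (f x); exists b.
pose B := \bigcup_(x in X) b x.
have B0 G x : B `<=` G -> coef_eval f G x = 0.
  move=> BG; apply: (generates_span Xgen x) (coef_zero_submod f G) _ 1.
  by move=> y Xy; apply: (bP y).2; apply: subset_trans BG; exact: bigcup_sup.
(* Extend coordinate by coordinate, choosing zero wherever [B] lies in [G], so that the extended
   family is still bounded by [B]. *)
have /choice[psi psiP] G : exists psi : {additive Q j -> QmodZ},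
    (forall x, psi (res_d Q j x) = coef_eval f G x) /\
    (B `<=` G -> forall x, psi x = 0).
  have [BG|nBG] := pselect (B `<=` G).
    by exists \0; split=> // x; rewrite B0.
  have [|psi psiE] := @character_extends _ _ (res_d Q j) (coef_eval f G).
    move=> x dx; have [y _ <-] : range (res_d Q j.+1) x by rewrite bd_exact.
    exact: (congr1 (fun c : coef C => val c G 1) (fd y)).
  by exists psi.
have psi0 (x : Q j) : eventually_zero C (fun G r => psi G (r *: x)).
  exists B; last by move=> G BG r; apply: (psiP G).2.
  split; first by apply: bigcup_finite => // y _; exact: (bP y).1.1.
  by move=> y [z _ /((bP z).1.2)].
exists (coef_map psi0) => x; apply/val_inj/funext => G; apply/funext => r /=.
by rewrite -linearZ_LR (psiP G).1 coef_eval_scale.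
Qed.

Lemma Ext_small_kernel (K : Type) (M : rmodType R) (P : proj_resolution M) n :
  infinite_set [set: K] -> lt_generated K (P n) ->
  Ext_eq0 n.+1 M (coef (range (res_d P n)) : rmodType R) ->
  exists G, [/\ card_lt G K, G `<=` range (res_d P n) &
    range (res_d P n) `<=` span G].
Proof.
set C := range _ => infK [X [XK Xgen]] ext.
have /choice[chi chiP] G : exists chi : {additive P n -> QmodZ},
    (forall y, span G y -> chi y = 0) /\
    (~ C `<=` span G -> exists2 x, C x & chi x != 0).
  have [G0 GL] := span_submod G.
  have GB x y : span G x -> span G y -> span G (x - y).
    by move=> Gx Gy; rewrite addrC -scaleN1r; exact: GL.
  have [CG|/existsNP[x /not_implyP[Cx Gx]]] := pselect (C `<=` span G).
    by exists \0.
  have [chi chi0 chix] := character_separates G0 GB x.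
  by exists chi; split=> // _; exists x => //; exact: chix.
pose chid G : {additive P n.+1 -> QmodZ} := chi G \o res_d P n.
have chid0 (x : P n.+1) : eventually_zero C (fun G r => chid G (r *: x)).
  (* If [G] contains this one element of [C], then [chi G] kills all its multiples. *)
  exists [set res_d P n x].
    by split; [exact: finite_set1|move=> _ ->; exists x].
  move=> G xG r; apply: (chiP G).1; have [G0 GL] := span_submod G.
  have : span G (r *: res_d P n x + 0).
    by apply: GL => //; apply: sub_span; exact: xG.
  by rewrite addr0 -linearZ_LR.
have [|g gE] := ext P (coef_map chid0).
  move=> x; apply/val_inj/funext => G; apply/funext => r /=.
  by rewrite linearZ_LR /= -[res_d P n _]/(bd P n.+1 _) bd_res_d scaler0 raddf0.
have /choice[b bP] x : exists b : set (P n), (finite_set b /\ b `<=` C) /\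
    forall G, b `<=` G -> forall r, val (g x) G r = 0.
  by have [b b1 b2] := coef_zero (g x); exists b.
pose G := \bigcup_(x in X) b x.
exists G; split.
- by apply: card_lt_bigcup_finite => // x; exact: (bP x).1.1.
- by move=> y [z _ /((bP z).1.2)].
(* The set [G] is tested at its own coordinate: [G] contains the bounds of all generators, so [g]
   vanishes there on all of [P n], whereas [chi G] would be nonzero somewhere on [C]. *)
apply: contrapT => /((chiP G).2)[_ [z _ <-] /eqP]; apply.
have -> : chi G (res_d P n z) = val (g (res_d P n z)) G 1.
  by rewrite -gE /= scale1r.
apply: (generates_span Xgen (res_d P n z)) (coef_zero_submod g G) _ 1.
by move=> y Xy; apply: (bP y).2; exact: bigcup_sup.
Qed.

End CoefficientExt.

(** * The free resolution *)

Section Resolution.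
Variables (K : Type) (R : pzRingType).

(* If the kernel has no generating set of cardinality < |K|, this is the whole
   kernel. *)
Definition small_generators (V W : rmodType R) (d : {linear V -> W}) : set V :=
  xget [set x | d x = 0] [set G | [/\ card_lt G K, G `<=` [set x | d x = 0] &
    [set x | d x = 0] `<=` span G]].

Lemma small_generators_span (V W : rmodType R) (d : {linear V -> W}) :
  span (small_generators d) = [set x | d x = 0].
Proof.
have [Gd dG] : small_generators d `<=` [set x | d x = 0] /\
    [set x | d x = 0] `<=` span (small_generators d).
  rewrite /small_generators; case: xgetP => [G _ []//|_].
  by split=> //; exact: sub_span.
apply/seteqP; split=> // x; apply=> //; exact: submod_ker.
Qed.

(** Bundling source and target lets the resolution be built by plain iteration although the modules
    change at each step. *)
Record arrow := Arrow {
  src : rmodType R; tgt : rmodType R; arr : {linear src -> tgt} }.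

Definition next_arrow (s : arrow) : arrow :=
  @Arrow (free_mod R^c (small_generators (arr s))) (src s)
    (free_eval (@idfun (src s))).

Variables (M : rmodType R) (X : set M).
Hypothesis Xgen : generates X.

Definition free_arrow n : arrow :=
  iter n next_arrow (@Arrow (free_mod R^c X) M (free_eval (@idfun M))).

Definition free_d n : {linear src (free_arrow n.+1) -> src (free_arrow n)} :=
  arr (free_arrow n.+1).

Lemma free_d_exact n :
  range (free_d n) = arr (free_arrow n) @^-1` [set 0].
Proof.
rewrite [LHS](free_eval_range (small_generators (arr (free_arrow n)))).
exact: small_generators_span.
Qed.

Lemma free_arrow_projective n : projective (src (free_arrow n)).
Proof. by case: n => [|n]; exact: free_projective. Qed.

Lemma free_aug_surj : range (arr (free_arrow 0)) = setT.
Proof.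
rewrite [LHS](free_eval_range X); apply/seteqP; split=> // x _.
exact: generates_span.
Qed.

Definition free_resolution : proj_resolution M :=
  @ProjResolution R M (fun n => src (free_arrow n)) free_d (arr (free_arrow 0))
    free_arrow_projective free_aug_surj (free_d_exact 0)
    (fun n => free_d_exact n.+1).

(** The range is the kernel of the preceding arrow, so the hypothesis rules out the default value in
    [small_generators]. *)
Lemma free_resolution_lt_generated n :
  (exists G, [/\ card_lt G K, G `<=` range (res_d free_resolution n) &
    range (res_d free_resolution n) `<=` span G]) ->
  lt_generated K (free_resolution n.+1).
Proof.
rewrite [range _](free_d_exact n) => exG.
apply: free_lt_generated; rewrite /small_generators.
by case: xgetP => [G _ []//|]; case: exG => G PG /(_ G).
Qed.

End Resolution.

Theorem corollary3p8 (R : pzRingType) (A B : rmodClass R) (K : Type)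
    (hAB : hereditary_cotorsion_pair A B) (hfin : finite_type B)
    (hK : infinite_set [set: K]) (M : rmodType R)
    (hM : A M) (hgen : lt_generated K M) :
  A M /\ mod_lt K M.
Proof.
split=> //; have [X [XK Xgen]] := hgen; have [S [Sfin SB]] := hfin.
(* Smallness climbs by degree: a small [P n] and vanishing Ext in degree [n.+1] give small
   generators for the next kernel. *)
pose P := free_resolution K Xgen; exists P; elim=> [|n IH].
  exact: free_lt_generated.
apply: free_resolution_lt_generated; apply: (Ext_small_kernel hK IH).
by apply: (hAB.1 M).1 => //; apply/SB; exact: coef_right_perp.
Qed.
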